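(* The number of labeled split graphs on $n$ vertices is $$\sum_{k=0}^n\binom{n}{k}2^{k(n-k)}-n\sum_{k=0}^{n-1}\binom{n-1}{k}2^{k(n-k-1)}.$$
   Context: Graphs are finite and simple. A split graph is a graph whose vertices can be partitioned into two (possibly empty) sets $K$ and $S$ such that $K$ is a clique and $S$ is a stable (independent) set. Labeled graphs on $n$ vertices are graphs with vertex set $\{1,\dots,n\}$. *)

(* Defs.v *)
From mathcomp Require Import all_boot all_order all_algebra.

Set Implicit Arguments.
Unset Strict Implicit.
Unset Printing Implicit Defensive.

(* A graph on the vertex type T is given by its edge set E, whose elements
   are unordered pairs of distinct vertices. *)
Definition simple_graph (T : finType) (E : {set {set T}}) : bool :=
  [forall e in E, #|e| == 2].

Definition clique (T : finType) (E : {set {set T}}) (K : {set T}) : bool :=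
  [forall x in K, forall y in K, (x != y) ==> ([set x; y] \in E)].

Definition stable (T : finType) (E : {set {set T}}) (S : {set T}) : bool :=
  [forall x in S, forall y in S, (x != y) ==> ([set x; y] \notin E)].

(* MathComp's [partition] excludes empty blocks; here K and S may be empty. *)
Definition split_graph (T : finType) (E : {set {set T}}) : bool :=
  [exists K : {set T}, exists S : {set T},
    [&& K :|: S == setT, [disjoint K & S], clique E K & stable E S]].

(* The label set {1, ..., n} is represented by 'I_n = {0, ..., n-1}. *)
Definition labeled_split_graphs (n : nat) : {set {set {set 'I_n}}} :=
  [set E | simple_graph E & split_graph E].

(* Main.v *)
(* Identify a split partition with its clique K. If K and L are cliques of two
   split partitions of E then K :\: L is both a clique and stable, so it has at
   most one element; hence the partitions of a fixed split graph, joined when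
   one arises from the other by moving a vertex v into the clique, form a star,
   and a star has one more vertex than edges. So the number of split graphs is
   the number of pairs (E, K) minus the number of triples (E, K, v). In a pair,
   exactly the edges between K and its complement are free; in a triple, v is
   joined to all of K and to nothing else, so the free edges are those between
   K and the n - 1 - #|K| remaining vertices. *)
Require Import Defs.
From mathcomp Require Import all_boot all_order all_algebra.
From mathcomp Require Import zify.

Set Implicit Arguments.
Unset Strict Implicit.
Unset Printing Implicit Defensive.

(** * Families of sets that are pairwise almost nested *)

Section NearbySets.
Variable T : finType.
Implicit Types (K L : {set T}) (F : {set {set T}}).

(** The covering relations of [F] under inclusion. Keeping the added element instead of the larger
    set allows counting them vertex by vertex. *)
Definition cover_pairs F : {set {set T} * T} :=
  [set p | [&& p.1 \in F, p.2 \notin p.1 & p.2 |: p.1 \in F]].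

(* The members of F have size m or m + 1, where m is the least size, and every
   small one lies in every large one. With a small and b large members there
   are a * b covering pairs, and a = 1 or b = 1. *)
Lemma card_cover_pairs F :
    F != set0 ->
    {in F &, forall K L, #|K :\: L| <= 1} ->
    {in F &, forall K L, K != L -> #|K| = #|L| ->
      (K :|: L \in F) || (K :&: L \in F)} ->
  #|F| = #|cover_pairs F|.+1.
Proof.
case/set0Pn=> K1 FK1 diffF joinF.
have [K0 FK0 minK0] : exists2 K0, K0 \in F & {in F, forall K, #|K0| <= #|K|}.
  by case: (arg_minnP (fun K => #|K|) FK1) => K; exists K.
set m := #|K0| in minK0.
pose A := [set K in F | #|K| == m]; pose B := [set K in F | #|K| == m.+1].
have leF K : K \in F -> #|K| <= m.+1.
  move=> FK; have := diffF _ _ FK FK0.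
  have := cardsID K0 K; have := subset_leq_card (subsetIr K K0).
  rewrite -/m; lia.
have defF : F = A :|: B.
  apply/setP=> K; rewrite !inE; case FK: (K \in F) => //=.
  have := minK0 _ FK; have := leF _ FK; lia.
have disAB : A :&: B = set0.
  apply/setP=> K; rewrite !inE; apply/negP=> /andP[/andP[_ /eqP->]].
  by case/andP=> _; rewrite ltn_eqF.
(* A large set has one element more than a small one, so [#|L :\: K| <= 1] leaves nothing for
   [K :\: L]. *)
have sAB K L : K \in A -> L \in B -> K \subset L.
  rewrite !inE => /andP[FK /eqP cK] /andP[FL /eqP cL].
  rewrite -setD_eq0 -cards_eq0; have := diffF _ _ FL FK.
  have := cardsID K L; have := cardsID L K; rewrite setIC; lia.
have cardW : #|cover_pairs F| = #|A| * #|B|.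
  rewrite -cardsX.
  (* The map to [(K, v |: K)] is a bijection onto [setX A B], since by [sAB] a large set is any
     small one plus one element. *)
  have injf : {in cover_pairs F &, injective (fun p => (p.1, p.2 |: p.1))}.
    move=> [K v] [L w]; rewrite !inE /= => /and3P[_ vK _] /and3P[_ wL _].
    case=> defL; move: wL; rewrite -{}defL => wK /setP/(_ v).
    by rewrite !inE eqxx (negPf vK) !orbF => /esym/eqP->.
  rewrite -(card_in_imset injf); congr #|pred_of_set _|.
  apply/setP=> -[K L]; apply/imsetP/setXP => /=.
    case=> -[K' v]; rewrite inE /= => /and3P[FK vK FL] [-> ->].
    rewrite !inE FK FL /=; move: (leF _ FL) (minK0 _ FK).
    by rewrite cardsU1 vK; lia.
  case=> AK BL; have sKL := sAB _ _ AK BL.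
  move: (AK) (BL); rewrite !inE => /andP[FK /eqP cK] /andP[FL /eqP cL].
  have /cards1P[v defv] : #|L :\: K| == 1.
    by have := cardsID K L; rewrite (setIidPr sKL); lia.
  have defL : L = v |: K.
    by rewrite -defv setUC -[LHS](setID L K) (setIidPr sKL).
  have vK : v \notin K.
    by have := set11 v; rewrite -defv inE => /andP[].
  by exists (K, v); rewrite ?inE /= -?defL // FK vK FL.
have A_gt0 : 0 < #|A|.
  by apply/card_gt0P; exists K0; rewrite inE FK0 /=.
have eqAB : #|A| = 1 \/ #|B| = 1.
  have [/card_le1P A1|/card_gt1P[K [L [AK AL neqKL]]]] := leqP #|A| 1.
    by left; apply/eqP; rewrite eqn_leq A_gt0 andbT; apply/card_le1P.
  (* Two distinct small sets meet in fewer than [m] elements, so their union is in [F]; every large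
     set contains that union and, by size, equals it. *)
  right.
  move: (AK) (AL); rewrite !inE => /andP[FK /eqP cK] /andP[FL /eqP cL].
  have cU : m < #|K :|: L|.
    rewrite -cK proper_card // properEneq subsetUl andbT.
    apply: contra neqKL => /eqP eqU.
    by rewrite eq_sym eqEcard cK cL leqnn {1}eqU subsetUr.
  have cI : #|K :&: L| < m.
    by have := cardsUI K L; lia.
  have FU : K :|: L \in F.
    have := joinF _ _ FK FL neqKL (etrans cK (esym cL)).
    by case/orP=> // /minK0; rewrite leqNgt cI.
  apply/eqP/cards1P; exists (K :|: L); apply/setP=> M; rewrite !in_set1.
  apply/idP/eqP=> [BM | ->].
    apply/esym/eqP; rewrite eqEcard subUset !sAB //=.
    by move: BM; rewrite inE => /andP[_ /eqP->].
  by rewrite inE FU eqn_leq leF.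
(* Here (a - 1)(b - 1) = 0, that is, a + b = ab + 1. *)
have := cardsUI A B; rewrite -defF disAB cards0 cardW.
by case: eqAB => ->; lia.
Qed.

End NearbySets.

(** * Split partitions of a fixed graph *)

Section SplitPartitions.
Variable T : finType.
Implicit Types (A B K S : {set T}) (E : {set {set T}}).

Definition split_cliques E : {set {set T}} :=
  [set K | clique E K & stable E (~: K)].

Definition pairs_in K : {set {set T}} :=
  [set e : {set T} | (#|e| == 2) && (e \subset K)].

Definition pairs_between A B : {set {set T}} :=
  [set [set p.1; p.2] | p in setX A B].

Lemma cliqueP E K :
  reflect {in K &, forall x y, x != y -> [set x; y] \in E} (clique E K).
Proof.
apply: (iffP forall_inP) => [cK x y Kx Ky xy | cK x Kx].
  by have /forall_inP/(_ y Ky)/implyP := cK x Kx; apply.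
by apply/forall_inP=> y Ky; apply/implyP; apply: cK.
Qed.

Lemma stableP E S :
  reflect {in S &, forall x y, x != y -> [set x; y] \notin E} (stable E S).
Proof.
apply: (iffP forall_inP) => [sS x y Sx Sy xy | sS x Sx].
  by have /forall_inP/(_ y Sy)/implyP := sS x Sx; apply.
by apply/forall_inP=> y Sy; apply/implyP; apply: sS.
Qed.

Lemma split_graphE E : split_graph E = (split_cliques E != set0).
Proof.
apply/existsP/set0Pn=> -[K].
  case/existsP=> S /and4P[/eqP KS dKS cK sS]; exists K; rewrite inE cK.
  suff -> : ~: K = S by [].
  apply/setP=> x; rewrite inE; move/setP/(_ x): KS; rewrite !inE.
  by have [/(disjointFr dKS)->|_] := boolP (x \in K).
rewrite inE => /andP[cK sK]; exists K; apply/existsP; exists (~: K).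
by rewrite setUCr eqxx cK sK -setI_eq0 setICr eqxx.
Qed.

Lemma card_clique_stable E K S :
  clique E K -> stable E S -> #|K :&: S| <= 1.
Proof.
move=> /cliqueP cK /stableP sS; rewrite leqNgt.
apply/negP=> /card_gt1P[x [y [/setIP[Kx Sx] /setIP[Ky Sy] xy]]].
by have := sS x y Sx Sy xy; rewrite cK.
Qed.

Lemma split_cliques_diff E :
  {in split_cliques E &, forall K L, #|K :\: L| <= 1}.
Proof.
move=> K L; rewrite !inE => /andP[cK _] /andP[_ sL].
by rewrite setDE (card_clique_stable cK sL).
Qed.

(* Write K = C + u and L = C + w: the union is a clique when uw is an edge,
   and the complement of the intersection is stable otherwise. *)
Lemma split_cliques_join E :
  {in split_cliques E &, forall K L, K != L -> #|K| = #|L| ->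
    (K :|: L \in split_cliques E) || (K :&: L \in split_cliques E)}.
Proof.
move=> K L FK FL neqKL eqKL.
have dKL := split_cliques_diff FK FL; have dLK := split_cliques_diff FL FK.
have : #|K :\: L| != 0.
  rewrite cards_eq0 setD_eq0; apply: contra neqKL => sKL.
  by rewrite eqEcard sKL eqKL leqnn.
rewrite -lt0n => dKL0.
have dLK0 : 0 < #|L :\: K|.
  by move: dKL0; have := cardsID K L; have := cardsID L K; rewrite setIC; lia.
have /cards1P[u du] : #|K :\: L| == 1 by rewrite eqn_leq dKL.
have /cards1P[w dw] : #|L :\: K| == 1 by rewrite eqn_leq dLK.
have inK x : x \in K -> x \notin L -> x = u.
  by move=> Kx Lx; apply/set1P; rewrite -du inE Lx.
have inL x : x \in L -> x \notin K -> x = w.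
  by move=> Kx Lx; apply/set1P; rewrite -dw inE Lx.
move: FK FL; rewrite !inE => /andP[/cliqueP cK /stableP sK].
move=> /andP[/cliqueP cL /stableP sL].
have [Euw | Euw] := boolP ([set u; w] \in E); apply/orP; [left | right].
  apply/andP; split; last first.
    apply/stableP=> x y; rewrite !inE !negb_or => /andP[Kx _] /andP[Ky _].
    by apply: sK; rewrite inE.
  apply/cliqueP=> x y; rewrite !inE => KLx KLy xy.
  have [Kx|Kx] := boolP (x \in K); have [Ky|Ky] := boolP (y \in K).
  - exact: cK.
  - have Ly : y \in L by move: KLy; rewrite (negPf Ky).
    have [Lx|Lx] := boolP (x \in L); first exact: cL.
    by rewrite (inK x) // (inL y).
  - have Lx : x \in L by move: KLx; rewrite (negPf Kx).
    have [Ly|Ly] := boolP (y \in L); first exact: cL.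
    by rewrite (inK y) // (inL x) // setUC.
  - by apply: cL => //; [move: KLx | move: KLy]; rewrite ?(negPf Kx) ?(negPf Ky).
apply/andP; split.
  by apply/cliqueP=> x y; rewrite !inE => /andP[Kx _] /andP[Ky _]; apply: cK.
apply/stableP=> x y; rewrite !inE !negb_and => KLx KLy xy.
have [Kx|Kx] := boolP (x \in K); have [Ky|Ky] := boolP (y \in K).
- move: KLx KLy; rewrite Kx Ky /= => Lx Ly.
  by apply: sL; rewrite ?inE.
- have Lx : x \notin L by move: KLx; rewrite Kx.
  have [Ly|Ly] := boolP (y \in L); last by apply: sL; rewrite ?inE.
  by rewrite (inK x) // (inL y).
- have Ly : y \notin L by move: KLy; rewrite Ky.
  have [Lx|Lx] := boolP (x \in L); last by apply: sL; rewrite ?inE.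
  by rewrite (inK y) // (inL x) // setUC.
- by apply: sK; rewrite ?inE.
Qed.

(** The boolean [split_graph E], read as 0 or 1, covers both cases: a graph that is not split has no
    partitions and no covering pairs. *)
Lemma card_split_cliques E :
  #|split_cliques E| = split_graph E + #|cover_pairs (split_cliques E)|.
Proof.
rewrite split_graphE; have [F0|Fn0] := eqVneq (split_cliques E) set0.
  rewrite F0 cards0 /= (_ : cover_pairs _ = set0) ?cards0 //.
  by apply/setP=> p; rewrite !inE.
by rewrite (card_cover_pairs Fn0) //;
  [apply: split_cliques_diff | apply: split_cliques_join].
Qed.

(** * Graphs with prescribed partitions as intervals of edge sets *)

Lemma clique_pairs_in E K : clique E K = (pairs_in K \subset E).
Proof.
apply/cliqueP/subsetP=> [cK e | sKE x y Kx Ky xy].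
  rewrite inE => /andP[/cards2P[x [y [xy ->]]]].
  by rewrite subUset !sub1set => /andP[Kx Ky]; apply: cK.
by apply: sKE; rewrite inE cards2 xy subUset !sub1set Kx Ky.
Qed.

Lemma pairs_betweenP A B x y :
  reflect (exists a b, [/\ a \in A, b \in B & [set x; y] = [set a; b]])
          ([set x; y] \in pairs_between A B).
Proof.
apply: (iffP imsetP) => [[[a b] /setXP[Aa Bb] ->] | [a [b [Aa Bb ->]]]].
  by exists a, b.
by exists (a, b); rewrite ?in_setX ?Aa.
Qed.

Lemma card_pairs_between A B :
  [disjoint A & B] -> #|pairs_between A B| = #|A| * #|B|.
Proof.
move=> dAB; rewrite -cardsX card_in_imset // => -[a b] [c d].
rewrite !in_setX /= => /andP[Aa Bb] /andP[Ac Bd] /setP eqS.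
have ac : a = c.
  have := eqS a; rewrite !inE eqxx /= => /esym/orP[/eqP//|/eqP ad].
  by have := disjointFr dAB Aa; rewrite ad Bd.
have bd : b = d.
  have := eqS b; rewrite !inE eqxx orbT => /esym/orP[/eqP bc|/eqP//].
  by have := disjointFl dAB Bb; rewrite bc Ac.
by rewrite ac bd.
Qed.

Lemma disjoint_pairs K A B :
  [disjoint K & B] -> [disjoint pairs_in K & pairs_between A B].
Proof.
move=> dKB; rewrite -setI_eq0; apply/eqP/setP=> e; rewrite !inE.
apply/negP=> /andP[/andP[_ sK] /imsetP[[a b] /setXP[/= Aa Bb] def_e]].
have Kb : b \in K by apply: (subsetP sK); rewrite def_e !inE eqxx orbT.
by have := disjointFr dKB Kb; rewrite Bb.
Qed.

(** Each member of the interval is [P :|: D] for a unique [D] inside [Q]. *)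
Lemma card_interval (U : finType) (P Q : {set U}) :
  [disjoint P & Q] ->
  #|[set E : {set U} | (P \subset E) && (E \subset P :|: Q)]| = 2 ^ #|Q|.
Proof.
move=> dPQ; rewrite -card_powerset.
have injU : {in powerset Q &, injective (fun D => P :|: D)}.
  have KU (D : {set U}) : D \in powerset Q -> (P :|: D) :\: P = D.
    rewrite inE => sDQ; rewrite setDUl setDv set0U; apply/setDidPl.
    by rewrite disjoint_sym; apply: disjointWr dPQ.
  by move=> D1 D2 /KU + /KU + eqD; rewrite eqD => <-.
rewrite -(card_in_imset injU); congr #|pred_of_set _|.
apply/setP=> E; rewrite inE; apply/andP/imsetP => [[sPE sEQ]|[D]].
  exists (E :\: P); first by rewrite inE subDset.
  by rewrite -[LHS](setID E P) (setIidPr sPE).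
by rewrite inE => sDQ ->; rewrite subsetUl setUS.
Qed.

(** Pairs inside [K] are forced, pairs outside [K] are excluded by stability, and crossing pairs are
    free. *)
Lemma split_cliques_interval E K :
  simple_graph E && (K \in split_cliques E) =
  (pairs_in K \subset E) && (E \subset pairs_in K :|: pairs_between K (~: K)).
Proof.
rewrite inE clique_pairs_in andbCA; congr (_ && _).
apply/andP/subsetP=> [[/forall_inP sE /stableP sK] e Ee | sE].
  have /cards2P[x [y [xy def_e]]] := sE e Ee.
  rewrite {}def_e in Ee *; rewrite inE.
  have [Kx|Kx] := boolP (x \in K); have [Ky|Ky] := boolP (y \in K).
  - by rewrite inE cards2 xy subUset !sub1set Kx Ky.
  - by apply/orP; right; apply/pairs_betweenP; exists x, y; rewrite inE.
  - apply/orP; right; apply/pairs_betweenP; exists y, x.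
    by rewrite inE; split; rewrite // setUC.
  - by have := sK x y; rewrite !inE Ee => /(_ Kx Ky xy).
split.
  apply/forall_inP=> e /sE; rewrite !inE => /orP[/andP[]//|].
  case/imsetP=> -[a b] /setXP[/= Ka Kb] ->; rewrite cards2.
  by case: (a =P b) Kb => // <-; rewrite inE Ka.
apply/stableP=> x y; rewrite !inE => Kx Ky xy; apply/negP=> /sE.
rewrite !inE subUset !sub1set (negPf Kx) andbF /=.
case/pairs_betweenP=> a [b [Ka _ /setP/(_ a)]]; rewrite !inE eqxx /=.
by case/orP=> /eqP eq_a; [have := Kx | have := Ky]; rewrite -eq_a Ka.
Qed.

(** The intervals for [K] and [v |: K] are intersected: stability of [~: K] denies [v] any neighbour
    outside [K], and the clique [v |: K] joins [v] to all of [K]. *)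
Lemma cover_pairs_interval E K v : v \notin K ->
  simple_graph E && ((K, v) \in cover_pairs (split_cliques E)) =
  (pairs_in (v |: K) \subset E) &&
  (E \subset pairs_in (v |: K) :|: pairs_between K (~: (v |: K))).
Proof.
(* Duplicating [simple_graph E] gives each of the two cliques its own copy, as
   [split_cliques_interval] requires. *)
move=> vK; rewrite inE /= vK /= -[simple_graph E]andbb andbACA.
rewrite !split_cliques_interval.
apply/andP/andP=> [[/andP[_ /subsetP sE1] /andP[sE2 /subsetP sE3]] | [sE1 sE2]].
  split=> //; apply/subsetP=> e Ee; have := sE3 e Ee; rewrite !inE.
  case/orP=> [->//|/imsetP[[a b] /setXP[/= Ka Kb] def_e]].
  have /norP[bv bK] : ~~ ((b == v) || (b \in K)) by rewrite !inE in Kb.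
  apply/orP; right; rewrite def_e in Ee *.
  apply/pairs_betweenP; exists a, b; split=> //.
  (* The case [a = v] is impossible: by the upper bound for [K], every edge has an endpoint in [K],
     but [v] and [b] lie outside it. *)
  move: Ka; rewrite !inE => /orP[/eqP eq_a|//].
  have := sE1 _ Ee; rewrite !inE eq_a subUset !sub1set (negPf vK) andbF /=.
  case/pairs_betweenP=> c [d [Kc _ /setP/(_ c)]]; rewrite !inE eqxx /=.
  by case/orP=> /eqP eq_c; [move: vK | move: bK]; rewrite -eq_c Kc.
have sKv : pairs_in K \subset pairs_in (v |: K).
  apply/subsetP=> e; rewrite !inE => /andP[->] /= sK.
  exact: subset_trans sK (subsetUr _ _).
rewrite (subset_trans sKv sE1) sE1 /=.
split; apply: subset_trans sE2 _; last first.
  by apply: setUS; apply: imsetS; apply: setXS; rewrite ?subsetUr.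
rewrite subUset; apply/andP; split; last first.
  apply: subset_trans (subsetUr _ _); apply: imsetS.
  by apply: setXS => //; rewrite setCS subsetUr.
apply/subsetP=> e; rewrite inE => /andP[/cards2P[x [y [xy ->]]]].
rewrite subUset !sub1set !in_setU1 => /andP[Kx Ky].
rewrite !inE cards2 xy subUset !sub1set.
case/orP: Kx => [/eqP eq_x|Kx]; case/orP: Ky => [/eqP eq_y|Ky].
- by rewrite eq_x eq_y eqxx in xy.
- apply/orP; right; apply/pairs_betweenP; exists y, x.
  by rewrite inE eq_x setUC.
- by apply/orP; right; apply/pairs_betweenP; exists x, y; rewrite inE eq_y.
- by rewrite Kx Ky.
Qed.

Lemma card_split_clique_graphs K :
  #|[set E : {set {set T}} | simple_graph E && (K \in split_cliques E)]| =
  2 ^ (#|K| * (#|T| - #|K|)).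
Proof.
have dK : [disjoint K & ~: K] by rewrite -setI_eq0 setICr.
under eq_finset do rewrite split_cliques_interval.
rewrite card_interval; last exact: disjoint_pairs.
by rewrite card_pairs_between // [#|~: _|]cardsCs setCK.
Qed.

Lemma card_cover_pair_graphs K v : v \notin K ->
  #|[set E : {set {set T}} |
      simple_graph E && ((K, v) \in cover_pairs (split_cliques E))]| =
  2 ^ (#|K| * (#|T| - #|K| - 1)).
Proof.
move=> vK.
have dK : [disjoint v |: K & ~: (v |: K)] by rewrite -setI_eq0 setICr.
under eq_finset do rewrite cover_pairs_interval //.
rewrite card_interval; last exact: disjoint_pairs.
rewrite card_pairs_between; last exact: disjointWl (subsetUr _ _) dK.
by rewrite [#|~: _|]cardsCs setCK cardsU1 vK addnC subnDA.
Qed.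

(** * Summation over cliques and added vertices *)

Lemma sum_powerset_card B (f : nat -> nat) :
  \sum_(A in powerset B) f #|A| =
  \sum_(0 <= k < #|B|.+1) 'C(#|B|, k) * f k.
Proof.
rewrite big_mkord.
rewrite (partition_big (fun A => inord #|A| : 'I_#|B|.+1) predT) //=.
apply: eq_bigr => k _; rewrite -cards_draws -sum_nat_const.
(* [inord] sends sizes above [#|B|] to 0, hence the restriction to subsets of [B]. *)
have eqk A : A \subset B -> (inord #|A| == k) = (#|A| == k).
  by move=> sAB; rewrite -val_eqE /= inordK // ltnS subset_leq_card.
apply: eq_big => [A | A /andP[]]; rewrite !inE; last first.
  by move=> sAB; rewrite eqk // => /eqP->.
by case sAB: (A \subset B); rewrite //= eqk.
Qed.

End SplitPartitions.

(** Double counting of the pairs [i], [j] with [j \in G i]; it turns sums over graphs into sums over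
    cliques. *)
Lemma sum_card_exchange (I J : finType) (P : pred I) (G : I -> {set J}) :
  \sum_(i | P i) #|G i| = \sum_j #|[set i | P i && (j \in G i)]|.
Proof.
under eq_bigr do rewrite -sum1_card.
rewrite (exchange_big_dep predT) //=.
by apply: eq_bigr => j _; rewrite -sum1dep_card.
Qed.

(** Stated additively because subtraction on [nat] truncates. It is [card_split_cliques] summed over
    all simple graphs. *)
Lemma card_labeled_split_graphs n :
  #|labeled_split_graphs n| +
    n * (\sum_(0 <= k < n) 'C(n - 1, k) * 2 ^ (k * (n - k - 1))) =
  \sum_(0 <= k < n.+1) 'C(n, k) * 2 ^ (k * (n - k)).
Proof.
pose V := 'I_n.
have cardF : \sum_(E : {set {set V}} | simple_graph E) #|split_cliques E| =
    \sum_(0 <= k < n.+1) 'C(n, k) * 2 ^ (k * (n - k)).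
  rewrite sum_card_exchange.
  under eq_bigr do rewrite card_split_clique_graphs.
  have := sum_powerset_card [set: V] (fun k => 2 ^ (k * (n - k))).
  rewrite cardsT card_ord => <-.
  by apply: eq_bigl => K; rewrite powersetT inE.
have cardW : \sum_(E : {set {set V}} | simple_graph E)
      #|cover_pairs (split_cliques E)| =
    n * (\sum_(0 <= k < n) 'C(n - 1, k) * 2 ^ (k * (n - k - 1))).
  rewrite sum_card_exchange.
  transitivity (\sum_(K : {set V}) \sum_(v : V)
      #|[set E : {set {set V}} |
        simple_graph E && ((K, v) \in cover_pairs (split_cliques E))]|).
    by rewrite pair_bigA; apply: eq_bigr => -[].
  rewrite exchange_big /= -[n in RHS]card_ord -sum_nat_const.
  (* A set containing [v] gives no covering pair with [v]; the remaining [K] are the subsets of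
     [[set~ v]]. *)
  apply: eq_bigr => v _; rewrite (bigID (fun K : {set V} => v \in K)) /=.
  rewrite big1 ?add0n => [|K vK]; last first.
    apply/eqP; rewrite cards_eq0; apply/eqP/setP=> E.
    by rewrite !inE /= vK !andbF.
  under eq_bigr do rewrite card_cover_pair_graphs //.
  have := sum_powerset_card [set~ v] (fun k => 2 ^ (k * (n - k - 1))).
  (* The vertex [v] itself shows that [n] is positive, so the bound [n.-1.+1] of the sum is [n]. *)
  have n_gt0 : 0 < n by case: v => i; apply: leq_ltn_trans.
  rewrite cardsC1 card_ord subn1 prednK // => <-.
  by apply: eq_big => K; rewrite ?card_ord // inE subsetC sub1set inE.
rewrite -cardF -cardW; under [in RHS]eq_bigr do rewrite card_split_cliques.
rewrite big_split /= -sum1_card; congr (_ + _).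
(* As a conditional between 1 and 0, [split_graph E] moves into the range of the sum. *)
rewrite -big_mkcondr; by apply: eq_bigl => E; rewrite inE.
Qed.

Theorem corollary3p4 (n : nat) :
  (#|labeled_split_graphs n|%:Z =
     (\sum_(0 <= k < n.+1) 'C(n, k) * 2 ^ (k * (n - k)))%N%:Z
     - (n * \sum_(0 <= k < n) 'C(n - 1, k) * 2 ^ (k * (n - k - 1)))%N%:Z)%R.
Proof.
by rewrite -card_labeled_split_graphs PoszD GRing.addrK.
Qed.
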